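(* Let $d\ge2$ and $n\ge1$ be integers and let $p$ be a prime. Then $p\mid D_d(0,n)$ if and only if there is some $c\in\overline{\mathbb{F}_p}$ such that $(0,0)$ is a periodic point of minimal period $n$ for the map $$F_{d,c}:\mathbb{A}^2\to\mathbb{A}^2,\qquad F_{d,c}(x,y)=(x^d+c,\; d\,x^{d-1}y+1)$$ over $\overline{\mathbb{F}_p}$.
   Context: Let $f_{d,c}(z)=z^d+c$, with $f_{d,c}^k$ its $k$-th iterate, and let $\mu$ be the Möbius function. $G_d(0,n)=\prod_{k\mid n}\left(f_{d,c}^k(0)\right)^{\mu(n/k)}$, a polynomial in $c$ with integer coefficients, and $D_d(0,n)=\operatorname{Disc}(G_d(0,n))$ is its discriminant as a polynomial in $c$ (the discriminant of a degree one polynomial being $1$). *)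

(* Defs.v *)
From HB Require Import structures.
From mathcomp Require Import all_boot all_order all_algebra all_field.
Set Implicit Arguments.
Unset Strict Implicit.
Unset Printing Implicit Defensive.
Import GRing.Theory.
Local Open Scope ring_scope.

(* For n > 0, logn q n == 1 for every prime divisor q of n means that n is
   squarefree. *)
Definition moebius (n : nat) : int :=
  if all (fun q => logn q n == 1%N) (primes n)
  then (-1) ^+ size (primes n) else 0.

Definition unicritical (R : nzRingType) (d : nat) (c z : R) : R := z ^+ d + c.

(* The parameter c is the indeterminate 'X. *)
Definition crit_orbit (d k : nat) : {poly int} :=
  iter k (unicritical d 'X) 0.

(* The factors with exponent 1 divided by those with exponent -1. The divisor
   is monic, so %/ is the genuine Euclidean quotient over int, and it is exact
   because the Moebius product is a polynomial: see dynatomic0_uniq. *)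
Definition dynatomic0 (d n : nat) : {poly int} :=
  (\prod_(k <- divisors n | moebius (n %/ k) == 1) crit_orbit d k)
  %/ (\prod_(k <- divisors n | moebius (n %/ k) == -1) crit_orbit d k).

(* With m = deg P, (-1)^(m(m-1)/2) * Res(P, P') / lead_coef P; the division is
   exact. *)
Definition disc (P : {poly int}) : int :=
  ((-1) ^+ 'C((size P).-1, 2) * resultant P P^`() %/ lead_coef P)%Z.

Definition disc_dynatomic0 (d n : nat) : int := disc (dynatomic0 d n).

Definition plane_map (R : nzRingType) (d : nat) (c : R) (v : R * R) : R * R :=
  (v.1 ^+ d + c, d%:R * v.1 ^+ d.-1 * v.2 + 1).

Definition minimal_period (T : Type) (f : T -> T) (x : T) (n : nat) : Prop :=
  [/\ (0 < n)%N, iter n f x = x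
    & forall m, (0 < m < n)%N -> iter m f x <> x].

Lemma moebius_cases n : [|| moebius n == 0, moebius n == 1 | moebius n == -1].
Proof.
rewrite /moebius; case: ifP => // _.
by rewrite -signr_odd; case: (odd _).
Qed.

Lemma crit_orbit_monic d k :
  (1 < d)%N -> (0 < k)%N -> crit_orbit d k \is monic.
Proof.
move=> d1; case: k => // k _.
suff [] : crit_orbit d k.+1 \is monic /\ (1 < size (crit_orbit d k.+1))%N by [].
elim: k => [|k [IHm IHs]].
  rewrite /crit_orbit /= /unicritical expr0n eqn0Ngt ltnW //= add0r.
  by rewrite monicX size_polyX.
rewrite /crit_orbit iterS -/(crit_orbit d k.+1) /unicritical.
set a := crit_orbit d k.+1 in IHm IHs *.
have lt2 : (2 < size (a ^+ d))%N.
  have := size_exp a d; have /monic_neq0 : a ^+ d \is monic by apply: monic_exp.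
  rewrite -size_poly_gt0; case: (size (a ^+ d)) => //= m _ ->; rewrite ltnS.
  by rewrite (leq_trans d1) // leq_pmull // -ltnS (ltn_predK IHs).
have ltX : (size ('X : {poly int}) < size (a ^+ d))%N by rewrite size_polyX.
rewrite size_polyDl // (ltn_trans _ lt2) //; split=> //.
by rewrite monicE lead_coefDl // -monicE monic_exp.
Qed.

(* dynatomic0 d n is the only polynomial whose image in the fraction field can
   be the Moebius product, read literally with negative exponents. *)
Lemma dynatomic0_uniq (d n : nat) (G : {poly int}) :
  (1 < d)%N ->
  tofrac G = \prod_(k <- divisors n) (tofrac (crit_orbit d k)) ^ moebius (n %/ k) ->
  G = dynatomic0 d n.
Proof.
move=> d1 GE; rewrite /dynatomic0; set A := \prod_(_ <- _ | _) _.
set B := \prod_(_ <- _ | _) _.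
have mon k : k \in divisors n -> crit_orbit d k \is monic.
  case: n {GE A B} => [|n kn]; first by rewrite inE => /eqP->; apply: crit_orbit_monic.
  by apply: crit_orbit_monic; rewrite // (dvdn_gt0 (ltn0Sn n)) // dvdn_divisors.
have Bm : B \is monic.
  by rewrite /B big_seq_cond; apply: monic_prod => k /andP[/mon].
suff -> : A = G * B.
  by rewrite Pdiv.IdomainMonic.mulpK.
apply/eqP; rewrite -tofrac_eq; apply/eqP; rewrite rmorphM /= GE /A /B !rmorph_prod /=.
rewrite [in LHS]big_mkcond [X in _ * X]big_mkcond /= -big_split /=.
rewrite big_seq [RHS]big_seq; apply: eq_bigr => k /mon /monic_neq0 k0.
have k0' : tofrac (crit_orbit d k) != 0 by rewrite tofrac_eq0.
case/or3P: (moebius_cases (n %/ k)) => /eqP->; rewrite /= ?expr0z ?mulr1 //.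
by rewrite exprN1 mulVf.
Qed.

(* Main.v *)
Require Import Defs.
From mathcomp Require Import all_boot all_order all_algebra all_field.
Set Implicit Arguments.
Unset Strict Implicit.
Unset Printing Implicit Defensive.
Import GRing.Theory.
Local Open Scope ring_scope.

(** Write a_k(c) for the k-th iterate of 0 under z^d + c, and G_n for the
    dynatomic product of the a_k with k | n.  The proof turns both sides of
    the equivalence into statements about the multiplicity of c as a root.

    On the plane side, a_(k+1) = a_k^d + c gives
    a_(k+1)' = d a_k^(d-1) a_k' + 1, so that the k-th iterate of (0,0) is
    (a_k(c), a_k'(c)) ([iter_plane_map]).  It returns to (0,0) exactly when c
    is a multiple root of a_k.

    On the discriminant side, G_n is monic over the integers, and its
    discriminant vanishes modulo p exactly when its reduction has a multiple
    root ([dvdz_disc_monic]).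

    The two are linked by rigid divisibility: if 0 has exact period m at the
    parameter c, and e is the multiplicity of c in a_m, then c has
    multiplicity e in every a_k with m | k and multiplicity 0 in the others
    ([mup_crit_poly]).  Indeed every iterate of z^d + c is its value at 0 plus
    a multiple of z^d, so a_(m+mk) and a_m agree modulo a_(mk)^d, which
    vanishes at c to order at least d e > e.  The sum of the Moebius function
    over the divisors of n/m then shows that c has multiplicity e in G_n if
    m = n, and 0 otherwise ([mup_moebius_part_period]).  Hence c is a
    multiple root of G_n if and only if it is a multiple root of a_n and 0 has
    exact period n, which is to say that (0,0) has minimal period n: if
    (0,0) has period n and 0 has exact period m, then c is already a multiple
    root of a_m, so (0,0) returns after m steps ([mup_dynatomic0_gt1]).

    The same computation over the algebraic numbers shows that the quotient
    defining G_n is exact ([dynatomic0_exact]), which is what allows G_n to be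
    reduced to other fields. *)

(** * Sums of the Moebius function *)

Lemma moebius_sq0 q j : prime q -> (0 < j)%N -> (q ^ 2 %| j)%N -> moebius j = 0.
Proof.
move=> q_pr j0 qj; have lg : (1 < logn q j)%N by rewrite -pfactor_dvdn.
rewrite /moebius ifN //; apply/allPn; exists q; last by rewrite gtn_eqF.
by rewrite -logn_gt0 ltnW.
Qed.

Lemma moebius_mul_prime q j :
  prime q -> (0 < j)%N -> ~~ (q %| j)%N -> moebius (q * j) = - moebius j.
Proof.
move=> q_pr j0 qj; have q0 := prime_gt0 q_pr.
have q_notin : q \notin primes j by rewrite mem_primes q_pr j0.
have pr_qj : perm_eq (primes (q * j)) (q :: primes j).
  apply: uniq_perm; rewrite /= ?q_notin ?primes_uniq // => r.
  by rewrite primesM // primes_prime // !inE.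
have lq : logn q (q * j) == 1%N.
  rewrite lognM // logn_prime // eqxx -[X in _ == X]addn0 eqn_add2l.
  by rewrite -leqn0 leqNgt logn_gt0.
rewrite /moebius (perm_all _ pr_qj) (perm_size pr_qj) /= lq /=.
rewrite (@eq_in_all _ _ (fun r => logn r j == 1%N)) => [|r rj].
  by case: ifP; rewrite ?oppr0 // exprS mulN1r.
by rewrite lognM // logn_prime // (negPf (memPn q_notin r rj)).
Qed.

(** With q a prime factor of N, the divisors j prime to q cancel against the
    divisors q * j, and those divisible by q^2 contribute nothing. *)
Lemma sum_moebius_divisors N :
  (0 < N)%N -> \sum_(j <- divisors N) moebius j = (N == 1)%N%:R.
Proof.
move=> N0; have [->|N1] := eqVneq N 1%N.
  by rewrite (_ : divisors 1 = [:: 1%N]) // big_seq1.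
have q_pr : prime (pdiv N) by rewrite pdiv_prime // ltn_neqAle eq_sym N1.
have q0 := prime_gt0 q_pr.
set q := pdiv N in q_pr q0.
have qN : (q %| N)%N := pdiv_dvd N.
have jP j : j \in divisors N -> (0 < j)%N.
  by rewrite -dvdn_divisors //; apply: dvdn_gt0.
rewrite (bigID (fun j => q %| j)%N) /= (bigID (fun j => q ^ 2 %| j)%N) /=.
rewrite big1_seq ?add0r => [|j /andP[/andP[_ /moebius_sq0] + /jP]]; last first.
  by move=> h /h->.
(* The divisors exactly divisible by q are the q * j with j prime to q. *)
have qsq : perm_eq [seq j <- divisors N | q %| j & ~~ (q ^ 2 %| j)]%N
   [seq (q * j)%N | j <- divisors N & ~~ (q %| j)%N].
  apply: uniq_perm; first by rewrite filter_uniq ?divisors_uniq.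
    rewrite map_inj_in_uniq ?filter_uniq ?divisors_uniq // => i j _ _ /eqP.
    by rewrite eqn_pmul2l // => /eqP.
  move=> j; rewrite mem_filter -dvdn_divisors //; apply/andP/mapP.
    case=> /andP[/dvdnP[i ->] qi] iN; exists i; last by rewrite mulnC.
    rewrite mem_filter -dvdn_divisors // (dvdn_trans (dvdn_mulr _ _) iN) // andbT.
    by apply: contra qi => qi; rewrite dvdn_mul.
  case=> i; rewrite mem_filter -dvdn_divisors // => /andP[qi iN] ->.
  rewrite dvdn_mulr //= dvdn_pmul2l // qi; split=> //.
  by rewrite Gauss_dvd ?qN ?iN // prime_coprime.
rewrite -big_filter (perm_big _ qsq) /= big_map big_filter -big_split /=.
by rewrite big1_seq // => j /andP[qj /jP j0]; rewrite moebius_mul_prime ?addNr.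
Qed.

(** The multiples k of m among the divisors of n are the n / j with
    j | n / m, so this is the sum over the divisors of n / m. *)
Lemma sum_moebius_quotients m n :
  (0 < n)%N -> (m %| n)%N ->
  \sum_(k <- divisors n | (m %| k)%N) moebius (n %/ k) = (n == m)%:R.
Proof.
move=> n0 mn; have m0 := dvdn_gt0 n0 mn.
have N0 : (0 < n %/ m)%N by rewrite divn_gt0 // dvdn_leq.
have ->: (n == m) = (n %/ m == 1)%N by rewrite -[RHS](eqn_pmul2r m0) divnK // mul1n.
rewrite -sum_moebius_divisors //.
have dK j : (j %| n)%N -> (n %/ (n %/ j))%N = j.
  by move=> jn; rewrite divnA // mulKn.
have jn j : j \in divisors (n %/ m) -> (j %| n)%N.
  rewrite -dvdn_divisors // => /dvdn_trans; apply.
  by rewrite -{2}(divnK mn) dvdn_mulr.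
have h : perm_eq [seq k <- divisors n | m %| k]%N
                 [seq (n %/ j)%N | j <- divisors (n %/ m)].
  apply: uniq_perm; first by rewrite filter_uniq ?divisors_uniq.
    rewrite map_inj_in_uniq ?divisors_uniq // => i j /jn iN /jn jN ij.
    by rewrite -(dK i) // ij dK.
  move=> k; rewrite mem_filter -dvdn_divisors //; apply/andP/mapP.
    case=> mk kn; exists (n %/ k)%N; last by rewrite dK.
    rewrite -dvdn_divisors // dvdn_divRL // -{2}(divnK kn) dvdn_pmul2l //.
    by rewrite divn_gt0 ?(dvdn_leq n0) ?(dvdn_gt0 n0).
  case=> j jN ->; have jn' := jn j jN; split; last by rewrite dvdn_div.
  rewrite dvdn_divRL // mulnC.
  by move: jN; rewrite -dvdn_divisors // dvdn_divRL.
rewrite -big_filter (perm_big _ h) /= big_map.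
by rewrite big_seq [RHS]big_seq; apply: eq_bigr => j /jn /dK->.
Qed.

(** * Multiplicities of roots *)

Lemma mup_gt1 (F : fieldType) (x : F) (q : {poly F}) :
  q != 0 -> (1 < mup x q)%N = root q x && root q^`() x.
Proof.
move=> q0; rewrite mup_geq // expr2.
have [/factor_theorem[r qr]|qx] := boolP (root q x); last first.
  apply: contraNF qx => /(dvdp_trans (dvdp_mulr _ (dvdpp _))).
  by rewrite dvdp_XsubCl.
rewrite qr dvdp_mul2r ?polyXsubC_eq0 // dvdp_XsubCl /=.
by rewrite /root derivM derivXsubC !hornerE subrr mulr0 add0r.
Qed.

Lemma mup_prod (F : fieldType) (x : F) I (s : seq I) (P : pred I)
    (q : I -> {poly F}) :
  (forall i, P i -> q i != 0) ->
  mup x (\prod_(i <- s | P i) q i) = \sum_(i <- s | P i) mup x (q i).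
Proof.
move=> q0; elim: s => [|i s IH]; first by rewrite !big_nil mupNroot ?root1.
rewrite !big_cons; case: ifP => // Pi; rewrite mupM ?IH ?q0 //.
by elim/big_ind: _ => [||j /q0] *; rewrite ?oner_neq0 ?mulf_neq0.
Qed.

Lemma mup_le_dvdp (F : closedFieldType) (p q : {poly F}) :
  p != 0 -> q != 0 -> (forall x, mup x p <= mup x q)%N -> p %| q.
Proof.
move=> p0 q0.
have [r pr] := closed_field_poly_normal p.
have [s qs] := closed_field_poly_normal q.
have cZ a (t : seq F) x : a != 0 ->
    mup x (a *: \prod_(z <- t) ('X - z%:P)) = count_mem x t.
  move=> a0; rewrite -mul_polyC mupMr ?mu_prod_XsubC //.
  by rewrite rootC.
rewrite pr qs dvdpZl ?dvdpZr ?lead_coef_eq0 // => le_rs.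
have /count_subseqP[t /subseqP[m _ ->] /(perm_big _)->] :
    forall x, (count_mem x r <= count_mem x s)%N.
  by move=> x; move: (le_rs x); rewrite !cZ ?lead_coef_eq0.
elim: s m {le_rs qs} => [|z s IH] [|b m]; rewrite ?big_nil ?dvd1p //.
case: b; rewrite /= ?big_cons; first exact: dvdp_mul.
exact: dvdp_mull.
Qed.

(** Multiplicity is a valuation, so it is unchanged by a perturbation of
    strictly higher order. *)
Lemma mup_addr (F : fieldType) (x : F) (p r : {poly F}) :
  p != 0 -> p + r != 0 -> ('X - x%:P) ^+ (mup x p).+1 %| r ->
  mup x (p + r) = mup x p.
Proof.
move=> p0 pr0 dvr; apply/eqP; rewrite eqn_leq mup_leq // mup_geq //.
have dvr' : ('X - x%:P) ^+ mup x p %| r.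
  by apply: dvdp_trans dvr; rewrite dvdp_exp2l.
by rewrite !dvdp_addl // -mup_leq // -mup_geq // leqnn.
Qed.

(** Division by a monic polynomial commutes with extension of scalars, so
    exactness may be tested over a field that contains R. *)
Lemma divp_monic_map (R : idomainType) (F : fieldType) (f : {rmorphism R -> F})
    (A B : {poly R}) :
  injective f -> B \is monic -> map_poly f B %| map_poly f A ->
  A = A %/ B * B.
Proof.
move=> f_inj Bm; have AE := Pdiv.IdomainMonic.divp_eq Bm A.
rewrite {1}AE rmorphD rmorphM /= dvdp_addr ?dvdp_mull // => dvR.
suff R0 : A %% B = 0 by rewrite {1}AE R0 addr0.
apply: (map_inj_poly f_inj (rmorph0 f)); rewrite rmorph0.
apply: contraTeq dvR => /dvdp_leq dvR; apply/negP => /dvR.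
rewrite !size_map_inj_poly ?rmorph0 // leqNgt ltn_modp.
by rewrite monic_neq0.
Qed.

(** * Discriminants and reduction *)

(** The degree of Q may drop under f, so this does not reduce to the vanishing
    criterion for the resultant of the images p and q.  The vanishing of the
    determinant of the image of the Sylvester matrix still says that
    u p + v q = 0 for some (u, v) <> 0 with size v <= deg p: if p and q are
    coprime then p divides v, hence v = 0, and u = 0 because p <> 0.
    Conversely a common factor r provides u = - q/r and v = p/r. *)
Lemma map_resultant_eq0 (R : comNzRingType) (F : fieldType)
    (f : {rmorphism R -> F}) (P Q : {poly R}) :
  P \is monic ->
  (f (resultant P Q) == 0) = ~~ coprimep (map_poly f P) (map_poly f Q).
Proof.
move=> Pm; set p := map_poly f P; set q := map_poly f Q.
have pm : p \is monic by apply: monic_map.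
have p0 := monic_neq0 pm.
have szp : size p = size P by rewrite size_map_poly_id0 // (monicP Pm) rmorph1 oner_eq0.
have szq : (size q <= size Q)%N by apply: size_poly.
have -> : f (resultant P Q) = \det (map_mx f (Sylvester_mx P Q)) by rewrite det_map_mx.
have -> : map_mx f (Sylvester_mx P Q) =
   col_mx (lin1_mx (poly_rV \o p \o* rVpoly)) (lin1_mx (poly_rV \o q \o* rVpoly)).
  rewrite map_col_mx; congr col_mx;
  by apply: map_lin1_mx => v; rewrite /= map_poly_rV rmorphM /= map_rVpoly.
have Pgt0 : (0 < size P)%N by rewrite size_poly_gt0 monic_neq0.
apply/det0P/idP => [[uv nz_uv]|].
  rewrite -[uv]hsubmxK in nz_uv *; rewrite mul_row_col !mul_rV_lin1 /=.
  set u := rVpoly _; set v := rVpoly _.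
  have szv : (size v <= (size P).-1)%N by apply: size_poly.
  move/(congr1 rVpoly)/eqP; rewrite -linearD linear0 poly_rV_K; last first.
    rewrite (leq_trans (size_polyD _ _)) // geq_max.
    rewrite !(leq_trans (size_polyMleq _ _)) //.
      rewrite -subn1 leq_subLR add1n -addSn addnC leq_add //.
      by rewrite (leq_trans szq) // leqSpred.
    rewrite szp -subn1 leq_subLR add1n -addnS prednK //.
    by rewrite leq_add2r size_poly.
  rewrite addrC addr_eq0 => /eqP vq_up; apply/negP => cpq.
  have pv : p %| v by rewrite -(Gauss_dvdpl _ cpq) vq_up -mulNr dvdp_mull.
  have v0 : v = 0.
    apply: contraTeq pv => v0; apply: contraL szv => /dvdp_leq-/(_ v0).
    by rewrite szp -ltnNge -{1}(prednK Pgt0).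
  case/negP: nz_uv; apply/eqP; rewrite -row_mx0.
  congr row_mx; apply: (can_inj rVpolyK); rewrite linear0 //.
  move/eqP: vq_up; rewrite v0 mul0r eq_sym oppr_eq0 mulf_eq0 (negPf p0) orbF.
  by move/eqP.
rewrite /coprimep; set r := gcdp p q => r1.
have /dvdpP[p' p'r] : r %| p by apply: dvdp_gcdl.
have /dvdpP[q' q'r] : r %| q by apply: dvdp_gcdr.
have r0 : r != 0 by rewrite gcdp_eq0 (negPf p0).
have p'0 : p' != 0 by apply: contraNneq p0 => p'0; rewrite p'r p'0 mul0r.
have def_r : (1 < size r)%N by rewrite ltn_neqAle eq_sym r1 size_poly_gt0.
have shrink (s : {poly F}) : (size s <= (size (s * r)%R).-1)%N.
  have [->|s0] := eqVneq s 0; first by rewrite size_poly0.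
  by rewrite size_mul // -(subnKC def_r) addnC /= leq_addl.
have szp' : (size p' <= (size P).-1)%N by rewrite -szp p'r shrink.
have szq' : (size (- q') <= (size Q).-1)%N.
  rewrite size_polyN (leq_trans (shrink _)) // -q'r.
  by rewrite -!subn1 leq_sub2r.
exists (row_mx (poly_rV (- q')) (poly_rV p')).
  apply: contraNneq p'0; rewrite -row_mx0 => /eq_row_mx[_ /(congr1 rVpoly)].
  by rewrite poly_rV_K // linear0 => ->.
rewrite mul_row_col !mul_rV_lin1 /= !poly_rV_K // -linearD /=.
by rewrite p'r q'r mulNr mulrCA addNr linear0.
Qed.

Lemma dvdz_pcharf (R : nzRingType) p (z : int) :
  p \in [pchar R] -> (p%:Z %| z)%Z = (z%:~R == 0 :> R).
Proof.
move=> pR; rewrite dvdzE /= (dvdn_pcharf pR).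
by case: z => n; rewrite ?NegzE ?abszN ?mulrNz ?oppr_eq0.
Qed.

Lemma exists_common_root (F : closedFieldType) (p q : {poly F}) :
  p != 0 -> ~~ coprimep p q <-> exists x, root p x && root q x.
Proof.
move=> p0; rewrite /coprimep; split=> [/closed_rootP[x]|[x rx]].
  by rewrite root_gcd; exists x.
by apply/closed_rootP; exists x; rewrite root_gcd.
Qed.

(** The resultant of P and P^`() reduces to 0 exactly when P and its
    derivative have a common root, that is, when P has a multiple root. *)
Lemma dvdz_disc_monic (K : closedFieldType) p (P : {poly int}) :
  p \in [pchar K] -> P \is monic ->
  (p%:Z %| disc P)%Z <-> exists x : K, (1 < mup x (map_poly intr P))%N.
Proof.
move=> pK Pm; have p0 : map_poly intr P != 0 :> {poly K}.
  by rewrite monic_neq0 ?monic_map.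
rewrite (dvdz_pcharf _ pK) /disc (monicP Pm) divz1 rmorphM /= rmorph_sign.
rewrite mulf_eq0 signr_eq0 /= map_resultant_eq0 // -deriv_map.
apply: (iff_trans (exists_common_root _ p0)).
by split=> -[x rx]; exists x; move: rx; rewrite mup_gt1.
Qed.

(** * The critical orbit *)

Definition crit_poly (F : fieldType) (d k : nat) : {poly F} :=
  map_poly intr (crit_orbit d k).

Lemma crit_polyE (F : fieldType) d k :
  crit_poly F d k = iter k (unicritical d 'X) 0.
Proof.
rewrite /crit_poly /crit_orbit.
elim: k => [|k IH]; first by rewrite /= rmorph0.
by rewrite !iterS -IH /unicritical rmorphD rmorphXn /= map_polyX.
Qed.

Lemma crit_polyS (F : fieldType) d k :
  crit_poly F d k.+1 = crit_poly F d k ^+ d + 'X.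
Proof. by rewrite !crit_polyE. Qed.

Lemma crit_poly_neq0 (F : fieldType) d k :
  (1 < d)%N -> (0 < k)%N -> crit_poly F d k != 0.
Proof.
by move=> d1 k0; rewrite monic_neq0 // monic_map // crit_orbit_monic.
Qed.

Lemma horner_crit_poly (F : fieldType) d k (c : F) :
  (crit_poly F d k).[c] = iter k (unicritical d c) 0.
Proof.
elim: k => [|k IH]; first by rewrite crit_polyE horner0.
by rewrite crit_polyS hornerD horner_exp hornerX IH iterS.
Qed.

Lemma root_crit_poly (F : fieldType) d k (c : F) :
  root (crit_poly F d k) c = (iter k (unicritical d c) 0 == 0).
Proof. by rewrite /root horner_crit_poly. Qed.

(** The second coordinate of the plane map is the recursion satisfied by the
    derivative of the critical orbit with respect to the parameter. *)
Lemma iter_plane_map (F : fieldType) d k (c : F) :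
  iter k (plane_map d c) (0, 0) =
  ((crit_poly F d k).[c], (crit_poly F d k)^`().[c]).
Proof.
elim: k => [|k IH]; first by rewrite crit_polyE /= deriv0 horner0.
rewrite iterS IH crit_polyS derivD derivX deriv_exp /plane_map /=.
by rewrite !hornerE hornerMn !hornerE mulr_natl mulrnAl mulrC.
Qed.

(** The first step produces z^d, and u - v divides u^d - v^d at each later
    step. *)
Lemma dvdp_iter_unicritical (F : fieldType) d m (a z : {poly F}) :
  (0 < d)%N -> (0 < m)%N ->
  z ^+ d %| iter m (unicritical d a) z - iter m (unicritical d a) 0.
Proof.
move=> d0; case: m => // m _; elim: m => [|m IH].
  by rewrite /= /unicritical expr0n eqn0Ngt d0 add0r addrK.
rewrite iterS [X in _ - X]iterS /unicritical opprD addrACA subrr addr0.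
by rewrite subrXX dvdp_mulr.
Qed.

(** Rigid divisibility: a_(m(k+1)) is a_m plus a multiple of a_(mk)^d, whose
    order of vanishing at c is at least d times that of a_m by induction; this
    is strictly larger because d > 1. *)
Lemma mup_crit_poly_mul (F : fieldType) d m k (c : F) :
  (1 < d)%N -> (0 < m)%N -> (0 < k)%N -> root (crit_poly F d m) c ->
  mup c (crit_poly F d (m * k)) = mup c (crit_poly F d m).
Proof.
move=> d1 m0; case: k => // k _ rt; elim: k => [|k IH]; first by rewrite muln1.
have mk0 : (0 < m * k.+1)%N by rewrite muln_gt0 m0.
have cm0 : crit_poly F d m != 0 by apply: crit_poly_neq0.
rewrite mulnS -[crit_poly F d (m + _)](subrKC (crit_poly F d m)).
apply: mup_addr => //; first by rewrite subrKC crit_poly_neq0 // addn_gt0 m0.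
rewrite -IH; set b := crit_poly F d (m * k.+1).
have b0 : b != 0 by apply: crit_poly_neq0.
apply: (@dvdp_trans _ (b ^+ d)); last first.
  rewrite !crit_polyE iterD -crit_polyE.
  by apply: dvdp_iter_unicritical => //; apply: ltnW.
apply: (@dvdp_trans _ (('X - c%:P) ^+ (mup c b * d))).
  rewrite dvdp_exp2l // (leq_trans _ (leq_mul (leqnn _) d1)) //.
  by rewrite muln2 -addnn -addn1 leq_add2l IH -XsubC_dvd ?dvdp_XsubCl.
by rewrite exprM dvdp_exp2r // -mup_geq.
Qed.

Lemma root_crit_poly_period (F : fieldType) d m k (c : F) :
  minimal_period (unicritical d c) 0 m ->
  root (crit_poly F d k) c = (m %| k)%N.
Proof.
case=> m0 fm min_m.
have fmk q : iter (q * m) (unicritical d c) 0 = 0.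
  by elim: q => //= q IH; rewrite mulSn iterD IH.
rewrite root_crit_poly {1}(divn_eq k m) addnC iterD fmk /dvdn.
have [->|r0] := posnP (k %% m)%N; first by rewrite eqxx.
apply/eqP; apply: min_m.
by rewrite r0 ltn_mod.
Qed.

Lemma exists_minimal_period (F : fieldType) d k (c : F) :
  (0 < k)%N -> root (crit_poly F d k) c ->
  exists m, minimal_period (unicritical d c) 0 m.
Proof.
rewrite root_crit_poly => k0 rk.
have ex : exists m, (0 < m)%N && (iter m (unicritical d c) 0 == 0).
  by exists k; rewrite k0.
case: (ex_minnP ex) => m /andP[m0 /eqP fm] min_m.
exists m; split=> // j /andP[j0 jm] /eqP fj.
by have := min_m j; rewrite j0 fj leqNgt jm => /(_ isT).
Qed.

Lemma mup_crit_poly (F : fieldType) d m k (c : F) :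
  (1 < d)%N -> minimal_period (unicritical d c) 0 m -> (0 < k)%N ->
  mup c (crit_poly F d k) = ((m %| k) * mup c (crit_poly F d m))%N.
Proof.
move=> d1 mP k0; have [m0 _ _] := mP.
have [/dvdnP[q kq]|mk] := boolP (m %| k)%N; last first.
  by rewrite mupNroot // (root_crit_poly_period _ mP).
move: k0; rewrite mul1n kq mulnC muln_gt0 => /andP[_ q0].
by apply: mup_crit_poly_mul; rewrite ?(root_crit_poly_period _ mP).
Qed.

(** * Multiplicities of the dynatomic polynomial *)

(** For s = 1 and s = -1, the numerator and the denominator of the dynatomic
    product over F. *)
Definition moebius_part (F : fieldType) d n (s : int) : {poly F} :=
  \prod_(k <- divisors n | moebius (n %/ k) == s) crit_poly F d k.

Lemma moebius_part_neq0 (F : fieldType) d n s :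
  (1 < d)%N -> (0 < n)%N -> moebius_part F d n s != 0.
Proof.
move=> d1 n0; rewrite /moebius_part big_seq_cond.
elim/big_ind: _ => [|? ? ? ?|k]; rewrite ?oner_neq0 ?mulf_neq0 //.
rewrite -dvdn_divisors // => /andP[/(dvdn_gt0 n0) k0 _].
exact: crit_poly_neq0.
Qed.

Lemma mup_moebius_part (F : fieldType) d n s (c : F) :
  (1 < d)%N -> (0 < n)%N ->
  mup c (moebius_part F d n s) =
  \sum_(k <- divisors n | moebius (n %/ k) == s) mup c (crit_poly F d k).
Proof.
move=> d1 n0; rewrite /moebius_part big_seq_cond [RHS]big_seq_cond.
apply: mup_prod => k /andP[+ _]; rewrite -dvdn_divisors // => /(dvdn_gt0 n0).
exact: crit_poly_neq0.
Qed.

Lemma mup_moebius_part_sub (F : fieldType) d n (c : F) :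
  (1 < d)%N -> (0 < n)%N ->
  (mup c (moebius_part F d n 1))%:Z - (mup c (moebius_part F d n (-1)))%:Z =
  \sum_(k <- divisors n) moebius (n %/ k) * (mup c (crit_poly F d k))%:Z.
Proof.
move=> d1 n0; rewrite !mup_moebius_part // !(big_morph Posz PoszD (erefl 0%:Z)).
rewrite [X in X - _]big_mkcond [X in _ - X]big_mkcond -sumrB /=.
apply: eq_bigr => k _.
by case/or3P: (moebius_cases (n %/ k)) => /eqP-> /=;
  rewrite ?subr0 ?sub0r ?mul0r ?mul1r ?mulN1r.
Qed.

(** The multiplicity of c in a_k is a constant on the multiples k of the
    period m and 0 elsewhere, so the Moebius-weighted sum collapses. *)
Lemma mup_moebius_part_period (F : fieldType) d n m (c : F) :
  (1 < d)%N -> (0 < n)%N -> minimal_period (unicritical d c) 0 m ->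
  mup c (moebius_part F d n 1) =
  (mup c (moebius_part F d n (-1)) + (n == m) * mup c (crit_poly F d n))%N.
Proof.
move=> d1 n0 mP; apply/eqP; rewrite -eqz_nat PoszD addrC -subr_eq.
rewrite mup_moebius_part_sub //; apply/eqP.
transitivity (\sum_(k <- divisors n | (m %| k)%N) moebius (n %/ k) *
               (mup c (crit_poly F d m))%:Z).
  rewrite [RHS]big_mkcond big_seq [RHS]big_seq; apply: eq_bigr => k.
  rewrite -dvdn_divisors // => /(dvdn_gt0 n0) k0.
  by rewrite (mup_crit_poly d1 mP k0); case: (m %| k)%N; rewrite ?mul1n ?mulr0.
have [mn|mn] := boolP (m %| n)%N.
  rewrite -mulr_suml sum_moebius_quotients //.
  by case: eqP => [->|_]; rewrite ?mul0r ?mul1r ?mul1n.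
rewrite (negPf (contraNneq _ mn)) => [|->//].
rewrite big1_seq // => k /andP[mk]; rewrite -dvdn_divisors // => kn.
by rewrite (dvdn_trans mk kn) in mn.
Qed.

Lemma mup_moebius_part_nonroot (F : fieldType) d n s (c : F) :
  (1 < d)%N -> (0 < n)%N -> ~~ root (crit_poly F d n) c ->
  mup c (moebius_part F d n s) = 0%N.
Proof.
move=> d1 n0 rn; rewrite mup_moebius_part // big1_seq // => k /andP[_].
rewrite -dvdn_divisors // => kn; apply: mupNroot; have k0 := dvdn_gt0 n0 kn.
apply: contra rn => rk; have [m mP] := exists_minimal_period k0 rk.
move: rk; rewrite !(root_crit_poly_period _ mP) => mk.
exact: dvdn_trans kn.
Qed.

Definition int_moebius_part (d n : nat) (s : int) : {poly int} :=
  \prod_(k <- divisors n | moebius (n %/ k) == s) crit_orbit d k.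

Lemma map_int_moebius_part (F : fieldType) d n s :
  map_poly intr (int_moebius_part d n s) = moebius_part F d n s.
Proof. by rewrite rmorph_prod. Qed.

Lemma int_moebius_part_monic d n s :
  (1 < d)%N -> (0 < n)%N -> int_moebius_part d n s \is monic.
Proof.
move=> d1 n0; rewrite /int_moebius_part big_seq_cond; apply: monic_prod => k.
rewrite -dvdn_divisors // => /andP[/(dvdn_gt0 n0) k0 _].
exact: crit_orbit_monic.
Qed.

(** Over a closed field divisibility is a comparison of multiplicities; those
    of the numerator exceed those of the denominator by the multiplicities that
    the dynatomic polynomial must have. *)
Lemma moebius_part_dvdp (F : closedFieldType) d n :
  (1 < d)%N -> (0 < n)%N -> moebius_part F d n (-1) %| moebius_part F d n 1.
Proof.
move=> d1 n0; apply: mup_le_dvdp => [||c]; rewrite ?moebius_part_neq0 //.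
have [rn|rn] := boolP (root (crit_poly F d n) c); last first.
  by rewrite !mup_moebius_part_nonroot.
have [m mP] := exists_minimal_period n0 rn.
by rewrite (mup_moebius_part_period d1 n0 mP) leq_addr.
Qed.

(** The algebraic numbers serve as a closed field into which the integers
    embed. *)
Lemma dynatomic0_exact d n :
  (1 < d)%N -> (0 < n)%N ->
  int_moebius_part d n 1 = dynatomic0 d n * int_moebius_part d n (-1).
Proof.
move=> d1 n0; apply: (@divp_monic_map _ algC intr).
- exact: intr_inj.
- exact: int_moebius_part_monic.
- by rewrite !map_int_moebius_part moebius_part_dvdp.
Qed.

Lemma dynatomic0_monic d n :
  (1 < d)%N -> (0 < n)%N -> dynatomic0 d n \is monic.
Proof.
move=> d1 n0; have := int_moebius_part_monic 1 d1 n0.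
by rewrite dynatomic0_exact // monicMr ?int_moebius_part_monic.
Qed.

Lemma mup_dynatomic0 (F : fieldType) d n (c : F) :
  (1 < d)%N -> (0 < n)%N ->
  (mup c (moebius_part F d n 1) =
   mup c (map_poly intr (dynatomic0 d n)) + mup c (moebius_part F d n (-1)))%N.
Proof.
move=> d1 n0; rewrite -!map_int_moebius_part dynatomic0_exact // rmorphM /=.
by rewrite mupM ?monic_neq0 // monic_map ?dynatomic0_monic ?int_moebius_part_monic.
Qed.

(** If (0,0) has minimal period n and 0 has exact period m under z^d + c, then
    c has the same multiplicity in a_m as in a_n, hence is a multiple root of
    a_m; by minimality m = n. *)
Lemma mup_dynatomic0_gt1 (F : fieldType) d n (c : F) :
  (1 < d)%N -> (0 < n)%N ->
  (1 < mup c (map_poly intr (dynatomic0 d n)))%N <->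
  minimal_period (plane_map d c) (0, 0) n.
Proof.
move=> d1 n0; have cn0 := crit_poly_neq0 F d1.
have fixE k : (0 < k)%N ->
    iter k (plane_map d c) (0, 0) = (0, 0) <-> (1 < mup c (crit_poly F d k))%N.
  move=> k0; rewrite mup_gt1 ?cn0 // iter_plane_map /root.
  by split=> [[-> ->]|/andP[/eqP-> /eqP->]]; rewrite ?eqxx.
have mupE := mup_dynatomic0 c d1 n0.
have [rn|rn] := boolP (root (crit_poly F d n) c); last first.
  move: mupE; rewrite !mup_moebius_part_nonroot // addn0 => <-; split=> //.
  by case=> _ /(fixE _ n0); rewrite mupNroot.
have [m mP] := exists_minimal_period n0 rn.
have mn : (m %| n)%N by rewrite -(root_crit_poly_period _ mP).
have [m0 _ _] := mP.
move: mupE; rewrite (mup_moebius_part_period d1 n0 mP) addnC => /addIn <-.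
have [nm|nm] := eqVneq n m; rewrite ?mul1n ?mul0n.
  split=> [/(fixE _ n0) fn|[_ /(fixE _ n0)]] //; split=> // k /andP[k0 kn].
  move/(fixE _ k0) => /ltnW; rewrite -XsubC_dvd ?cn0 // dvdp_XsubCl.
  by rewrite (root_crit_poly_period _ mP) -nm => /(dvdn_leq k0); rewrite leqNgt kn.
split=> // -[_ /(fixE _ n0) fn /(_ m)]; case.
  by rewrite m0 ltn_neqAle eq_sym nm dvdn_leq.
apply/(fixE _ m0); move: fn; rewrite (mup_crit_poly d1 mP n0) mn mul1n.
exact.
Qed.

Theorem theorem4p5 (d n p : nat) (hd : (2 <= d)%N) (hn : (1 <= n)%N)
    (hp : prime p)
    (K : closedFieldType) (iota : {rmorphism 'F_p -> K})
    (hK : integralRange iota) :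
  (p%:Z %| disc_dynatomic0 d n)%Z <->
  exists c : K, minimal_period (plane_map d c) (0, 0) n.
Proof.
have pK : p \in [pchar K].
  by apply: (rmorph_pchar iota); apply: pchar_Fp.
apply: (iff_trans (dvdz_disc_monic pK (dynatomic0_monic hd hn))).
by split=> -[c /(mup_dynatomic0_gt1 c hd hn)]; exists c.
Qed.
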